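(* Let $N$ be a positive integer and let $H^2_{\beta}$ be a weighted Hardy space of $N$-polynomial growth induced by the weight sequence $w=\{w_k\}_{k=1}^{\infty}$. Then for any disk automorphism $\varphi\in \mathrm{Aut}(\mathbb{D})$, written as $\varphi(z)=e^{i\theta}\frac{z_0-z}{1-\overline{z_0}z}$ with $\theta\in\mathbb{R}$ and $z_0\in\mathbb{D}$, there exists a positive number $K$ such that $$\|C_\varphi\|_{H^2_{\beta}}\leq \frac{K}{(1-|z_0|)^{2N^2+3N+2}}.$$
   Context: $\mathbb{D}$ is the open unit disk and $\mathrm{Aut}(\mathbb{D})$ the group of analytic bijections of $\mathbb{D}$. Let $w=\{w_k\}_{k\ge1}$ be a sequence of positive numbers with $w_k\to1$, and put $\beta_0=1$, $\beta_k=\prod_{j=1}^k w_j$. The weighted Hardy space $H^2_\beta$ is the Hilbert space of analytic functions $f(z)=\sum_{k\ge0}\widehat f(k)z^k$ on $\mathbb{D}$ with $\|f\|_{H^2_\beta}^2=\sum_{k\ge0}|\widehat f(k)|^2\beta_k^2<\infty$. It is said to be of $N$-polynomial growth if $\frac{k+1}{k+N+1}\le w_k\le\frac{k+N+1}{k+1}$ for all $k\ge1$. The composition operator is $C_\varphi f=f\circ\varphi$, and $\|T\|_{H^2_\beta}$ is the operator norm of $T$ on $H^2_\beta$. *)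

(* Defs.v *)
(* Built on the standard library reals and Coquelicot. *)
From Stdlib Require Export Reals.
From Stdlib Require Import ClassicalEpsilon.
From Coquelicot Require Export Coquelicot.
Open Scope R_scope.

Definition in_disk (z : C) : Prop := Cmod z < 1.

(* Functions on the disk are total maps [C -> C] whose values outside the disk
   are irrelevant; since the disk is open, differentiability at its points
   does not see those values. *)
Definition analytic_on_disk (f : C -> C) : Prop :=
  forall z : C, in_disk z ->
    ex_derive (K := C_AbsRing) (V := C_NormedModule) f z.

Definition disk_automorphism (phi : C -> C) : Prop :=
  analytic_on_disk phi /\
  (forall z, in_disk z -> in_disk (phi z)) /\
  (forall z1 z2, in_disk z1 -> in_disk z2 -> phi z1 = phi z2 -> z1 = z2) /\
  (forall u, in_disk u -> exists z, in_disk z /\ phi z = u).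

Definition power_series_on_disk (f : C -> C) (a : nat -> C) : Prop :=
  forall z : C, in_disk z ->
    is_pseries (K := C_AbsRing) (V := C_NormedModule) a z (f z).

(* The coefficients hat f(k) of f(z) = sum_k hat f(k) z^k on the disk. They are
   unique when they exist, so the choice is immaterial for such [f]; for other
   [f] the value is a junk sequence. *)
Definition fhat (f : C -> C) : nat -> C :=
  epsilon (inhabits (fun _ : nat => RtoC 0)) (power_series_on_disk f).

(* [w 0] is never used: the weights are w_1, w_2, ... *)
Fixpoint beta (w : nat -> R) (k : nat) : R :=
  match k with
  | O => 1
  | S j => beta w j * w (S j)
  end.

Definition weight_sequence (w : nat -> R) : Prop :=
  (forall k : nat, (1 <= k)%nat -> 0 < w k) /\ is_lim_seq w 1.

Definition polynomial_growth (N : nat) (w : nat -> R) : Prop :=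
  forall k : nat, (1 <= k)%nat ->
    INR (k + 1) / INR (k + N + 1) <= w k <= INR (k + N + 1) / INR (k + 1).

Definition H2_norm_term (w : nat -> R) (f : C -> C) (k : nat) : R :=
  Cmod (fhat f k) ^ 2 * beta w k ^ 2.

(* The middle conjunct is Taylor's theorem for an analytic [f]; it is kept so
   that [fhat f] visibly is the coefficient sequence of [f]. *)
Definition in_H2 (w : nat -> R) (f : C -> C) : Prop :=
  analytic_on_disk f /\
  power_series_on_disk f (fhat f) /\
  ex_series (H2_norm_term w f).

Definition H2_norm (w : nat -> R) (f : C -> C) : R :=
  sqrt (Series (H2_norm_term w f)).

Definition composition_operator (phi : C -> C) (f : C -> C) : C -> C :=
  fun z => f (phi z).

Definition maps_H2_to_H2 (w : nat -> R) (T : (C -> C) -> (C -> C)) : Prop :=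
  forall f : C -> C, in_H2 w f -> in_H2 w (T f).

(* The supremum is taken in the extended reals. It is the operator norm of [T]
   on the weighted Hardy space when [maps_H2_to_H2 w T] holds, and then [T] is
   bounded iff the supremum is finite. *)
Definition operator_norm (w : nat -> R) (T : (C -> C) -> (C -> C)) : Rbar :=
  Lub_Rbar (fun r : R =>
    exists f : C -> C, in_H2 w f /\ H2_norm w f <= 1 /\ r = H2_norm w (T f)).

(* Main.v *)
(* Up to rotations, an automorphism is [mobius s u = (u + s) / (1 + s u)] with
   [s = |z0|]. The Taylor coefficients [a_k] of [f o mobius s] satisfy
     [(1 - s^2) da_k/ds = (k+1) a_{k+1} - (k-1) a_{k-1}],
   so that [(1 - s^2) d/ds sum_k beta_k^2 |a_k|^2] equals
   [2 Re sum_k ((k+1) beta_k^2 - k beta_{k+1}^2) conj(a_k) a_{k+1}]. Polynomial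
   growth gives [|(k+1) beta_k^2 - k beta_{k+1}^2| <= (2N+1) beta_k beta_{k+1}],
   whence by Gronwall [|C_phi|^2 <= ((1+s)/(1-s))^(2N+1)], first on polynomials
   and then on the whole space. *)

(* The energy of a composed function is never differentiated as an infinite series. It is cut off at
   an index [n], which makes it a finite sum but leaves the boundary term
   [(n+1) beta_n^2 a_n a_(n+1)]. When [f] is a polynomial, the coefficients after substitution decay
   like [q^k] with [q < 1], uniformly for [s] in [[0, s0]], while [beta_(n+1) / beta_n] tends to 1;
   so the boundary term vanishes as [n] grows. For a general [f] no such decay is at hand, which is
   why polynomials come before the whole space. The extension rests on duality: the polynomial
   bound, tested on a well-chosen polynomial, shows that each column
   [m |-> mobius_coef s m k / beta_m] is square-summable, so the series defining each new
   coefficient converges. All [mobius_coef] are real, hence the estimates run on real sequences, and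
   complex ones are split into real and imaginary parts. *)
Require Import Defs.
From Stdlib Require Import Reals Lra Lia Arith.
From Coquelicot Require Import Coquelicot.
Open Scope R_scope.

(** * Taylor coefficients of the powers of a Moebius map *)

(* [mobius_coef s m k] is the coefficient of [u^k] in [((u + s) / (1 + s u))^m];
   the recursion is [(1 + s u) Q = (u + s) P] for consecutive powers [P], [Q]. *)
Fixpoint mobius_coef (s : R) (m : nat) : nat -> R :=
  match m with
  | O => fun k => match k with O => 1 | S _ => 0 end
  | S m' => fix row (k : nat) : R :=
      match k with
      | O => s * mobius_coef s m' O
      | S k' => mobius_coef s m' k' + s * mobius_coef s m' (S k') - s * row k'
      end
  end.

Lemma mobius_coef_S0 s m : mobius_coef s (S m) 0 = s * mobius_coef s m 0.
Proof. reflexivity. Qed.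

Lemma mobius_coef_SS s m k :
  mobius_coef s (S m) (S k)
  = mobius_coef s m k + s * mobius_coef s m (S k) - s * mobius_coef s (S m) k.
Proof. reflexivity. Qed.

Lemma mobius_coef_at_0 m k : mobius_coef 0 m k = if Nat.eq_dec m k then 1 else 0.
Proof.
  revert k; induction m as [|m IH]; intros [|k]; try reflexivity.
  - rewrite mobius_coef_S0; simpl; ring.
  - rewrite mobius_coef_SS, !IH.
    destruct (Nat.eq_dec m k), (Nat.eq_dec (S m) (S k)); try lia; ring.
Qed.

(** Along a row the recursion multiplies the previous entry by [-s], and [s <= s0 < q], so a forcing
    term of order [q^k] coming from the row above yields a solution of order [q^k]. The bound is
    uniform in [s] because it is used on the whole interval [[0, s0]] at once. *)
Lemma mobius_coef_decay (q : R) (m : nat) : 0 < q < 1 ->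
  forall s0, 0 <= s0 < q ->
  exists M, 0 <= M /\
    forall s k, 0 <= s <= s0 -> Rabs (mobius_coef s m k) <= M * q ^ k.
Proof.
  intros Hq s0 Hs0; induction m as [|m [M [HM IH]]].
  - exists 1; split; [lra|]; intros s [|k] _; simpl.
    + rewrite Rabs_R1; lra.
    + rewrite Rabs_R0.
      assert (0 <= q ^ k) by (apply pow_le; lra); nra.
  (* Each of the two terms from row [m] is at most [M q^k]; the constant [M'] solves
     [M' q = s0 M' + 2 M]. *)
  - exists (2 * M / (q - s0)); split.
    { apply Rmult_le_pos; [lra|]; left; apply Rinv_0_lt_compat; lra. }
    set (M' := 2 * M / (q - s0)).
    assert (HM' : M' * (q - s0) = 2 * M) by (unfold M'; field; lra).
    assert (HM0 : 0 <= M').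
    { unfold M'; apply Rmult_le_pos; [lra|]; left; apply Rinv_0_lt_compat; lra. }
    intros s k Hs; induction k as [|k IHk].
    + rewrite mobius_coef_S0, Rabs_mult, (Rabs_pos_eq s) by lra.
      specialize (IH s O Hs); simpl in *.
      pose proof (Rabs_pos (mobius_coef s m 0)); nra.
    + rewrite mobius_coef_SS.
      pose proof (IH s k Hs) as H1; pose proof (IH s (S k) Hs) as H2.
      simpl pow in *.
      assert (Hp : 0 <= q ^ k) by (apply pow_le; lra).
      set (x := mobius_coef s m k) in *; set (y := mobius_coef s m (S k)) in *.
      set (z := mobius_coef s (S m) k) in *.
      assert (Rabs (x + s * y - s * z) <= Rabs x + s * Rabs y + s * Rabs z).
      { unfold Rminus; eapply Rle_trans; [apply Rabs_triang|].
        rewrite Rabs_Ropp, Rabs_mult, (Rabs_pos_eq s) by lra.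
        apply Rplus_le_compat_r; eapply Rle_trans; [apply Rabs_triang|].
        rewrite Rabs_mult, (Rabs_pos_eq s) by lra; lra. }
      assert (s * Rabs y <= M * q ^ k).
      { pose proof (Rabs_pos y). assert (M * (q * q ^ k) <= M * q ^ k).
        { apply Rmult_le_compat_l; nra. }
        nra. }
      assert (s * Rabs z <= s0 * (M' * q ^ k)).
      { pose proof (Rabs_pos z); apply Rmult_le_compat; lra. }
      replace (M' * (q * q ^ k)) with (s0 * (M' * q ^ k) + M' * (q - s0) * q ^ k) by ring.
      rewrite HM'; lra.
Qed.

(* Coefficients of [(1 - u^2) Q'(u)] when [Q(u) = sum_k q k u^k]. *)
Definition flow_coef (q : nat -> R) (k : nat) : R :=
  INR (k + 1) * q (S k) - match k with O => 0 | S j => INR j * q j end.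

Lemma is_derive_id_mult (f : R -> R) (s df : R) :
  is_derive f s df -> is_derive (fun s => s * f s) s (f s + s * df).
Proof.
  intros H; evar_last.
  { apply (is_derive_mult (fun s => s) f);
      [apply is_derive_id | exact H | intros; apply Rmult_comm]. }
  apply (f_equal (fun x => x + s * df)), Rmult_1_l.
Qed.

(** In terms of functions, [Q = (mobius s u)^m] satisfies [(1 - s^2) dQ/ds = (1 - u^2) dQ/du], since
    both derivatives of [mobius s u] are explicit multiples of [1 / (1 + s u)^2]. Here the identity
    is checked coefficientwise by a double induction along the recursion, so no interchange of
    derivative and series occurs. *)
Lemma mobius_coef_derive (m k : nat) (s : R) : -1 < s < 1 ->
  is_derive (fun s => mobius_coef s m k) s
    (flow_coef (mobius_coef s m) k / (1 - s ^ 2)).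
Proof.
  intros Hs; assert (Hd : 1 - s ^ 2 <> 0) by nra.
  revert k; induction m as [|m IHm]; intros k.
  - replace (_ / _) with 0; [destruct k; apply is_derive_Reals, derivable_pt_lim_const|].
    unfold flow_coef; destruct k as [|[|k]]; simpl; field; lra.
  - induction k as [|k IHk].
    + apply (is_derive_ext (fun s => s * mobius_coef s m 0)); [reflexivity|].
      evar_last; [apply is_derive_id_mult, IHm|].
      unfold flow_coef; rewrite mobius_coef_SS, mobius_coef_S0; simpl INR; field; auto.
    + apply (is_derive_ext (fun s => mobius_coef s m k + s * mobius_coef s m (S k)
                                     - s * mobius_coef s (S m) k)); [reflexivity|].
      assert (H : forall a b c : R -> R, forall a' b' c', is_derive a s a' ->
        is_derive b s b' -> is_derive c s c' ->
        is_derive (fun s => a s + b s - c s) s (a' + b' - c')).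
      { intros a b c a' b' c' Ha Hb Hc.
        apply (is_derive_minus (fun s => a s + b s) c); auto.
        now apply (is_derive_plus a b). }
      evar_last.
      { apply H; [apply IHm | apply is_derive_id_mult, IHm
                 | apply is_derive_id_mult, IHk]. }
      clear H; unfold flow_coef.
      rewrite (mobius_coef_SS s m (S k)).
      destruct k as [|j].
      * rewrite (mobius_coef_SS s m 0), mobius_coef_S0; simpl INR; field; auto.
      * rewrite (mobius_coef_SS s m (S j)).
        assert (Hj := mobius_coef_SS s m j).
        (* The recursion one index lower, solved for the entry of row [m], ties the term
           [j * mobius_coef s m j] to the entries of row [S m] in the target. *)
        replace (mobius_coef s m j) with
          (mobius_coef s (S m) (S j) - s * mobius_coef s m (S j)
           + s * mobius_coef s (S m) j) by (rewrite Hj; ring).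
        rewrite !plus_INR, !S_INR; simpl INR.
        field; auto.
Qed.

(** * The energy inequality *)

Lemma sum_Sn_R (f : nat -> R) n : sum_n f (S n) = sum_n f n + f (S n).
Proof. exact (sum_Sn f n). Qed.

Lemma beta_pos (w : nat -> R) : weight_sequence w -> forall k, 0 < beta w k.
Proof.
  intros [Hw _] k; induction k as [|k IH]; simpl; [lra|].
  apply Rmult_lt_0_compat; [exact IH | apply Hw; lia].
Qed.

(** Here [w] stands for the weight of index [k + 1] and [x] for [k + 2]. The constant [2N + 1] is
    what the extreme weight [x / (x + N)] produces as [k] tends to infinity. *)
Lemma growth_gap (N k : nat) (w : R) :
  INR (S k + 1) / INR (S k + N + 1) <= w <= INR (S k + N + 1) / INR (S k + 1) ->
  Rabs (INR (k + 1) - INR k * w ^ 2) <= (2 * INR N + 1) * w.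
Proof.
  rewrite !plus_INR, !S_INR; simpl INR.
  pose proof (pos_INR k) as Hk; pose proof (pos_INR N) as HN.
  set (x := INR k + 1 + 1) in *.
  replace (INR k + 1 + INR N + 1) with (x + INR N) by (unfold x; ring).
  replace (INR k + 1) with (x - 1) by (unfold x; ring).
  replace (INR k) with (x - 2) by (unfold x; ring).
  assert (Hx : 2 <= x) by (unfold x; lra); clearbody x; clear Hk k.
  revert HN; generalize (INR N); intros n HN [Hl Hu].
  apply Rle_div_l in Hl; [|lra]; apply Rle_div_r in Hu; [|lra].
  assert (Hw : 0 < w) by nra.
  apply Rabs_le; split.
  - destruct (Rle_dec w 1).
    + nra.
    + assert (w * x * w <= (x + n) * w) by (apply Rmult_le_compat_r; lra).
      nra.
  (* The right side increases with [w], so the worst case is the smallest admissible weight [l];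
     there, after clearing denominators, the difference of the two sides is exactly
     [x (n^2 x + 3 n x + n^2)]. *)
  - assert (Hm : x * (x - 1) <= (x - 2) * w * (w * x) + (2 * n + 1) * (w * x)).
    { set (l := x / (x + n)).
      assert (Hlw : l <= w) by (apply Rle_div_l; lra).
      assert (Hl0 : 0 < l) by (apply Rdiv_lt_0_compat; lra).
      assert (Hlx : l * (x + n) = x) by (unfold l; field; lra).
      assert ((x - 2) * l * (l * x) <= (x - 2) * w * (w * x)).
      { apply Rmult_le_compat; nra. }
      assert ((2 * n + 1) * (l * x) <= (2 * n + 1) * (w * x)).
      { apply Rmult_le_compat_l; [|apply Rmult_le_compat_r]; lra. }
      assert (x * (x - 1) <= (x - 2) * l * (l * x) + (2 * n + 1) * (l * x)); [|lra].
      assert (Hn : l * n = x - l * x) by lra.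
      apply Rmult_le_reg_r with ((x + n) * (x + n)); [nra|].
      replace (((x - 2) * l * (l * x) + (2 * n + 1) * (l * x)) * ((x + n) * (x + n)))
        with ((x - 2) * x * (l * (x + n)) * (l * (x + n))
              + (2 * n + 1) * x * (x + n) * (l * (x + n))) by ring.
      rewrite Hlx.
      assert (0 <= x * (n * n * x + 3 * n * x + n * n)).
      { apply Rmult_le_pos; [lra|]. assert (0 <= n * n * x) by (apply Rmult_le_pos; nra).
        nra. }
      nra. }
    apply Rmult_le_reg_r with x; [lra|]; lra.
Qed.

Lemma beta_gap (N : nat) (w : nat -> R) (k : nat) :
  weight_sequence w -> polynomial_growth N w ->
  Rabs (INR (k + 1) * beta w k ^ 2 - INR k * beta w (S k) ^ 2)
    <= (2 * INR N + 1) * (beta w k * beta w (S k)).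
Proof.
  intros Hw Hg.
  pose proof (beta_pos w Hw k) as Hb.
  simpl beta.
  replace (_ - _) with (beta w k ^ 2 * (INR (k + 1) - INR k * w (S k) ^ 2)) by ring.
  rewrite Rabs_mult, Rabs_pos_eq by (apply pow2_ge_0).
  replace (_ * (_ * _)) with (beta w k ^ 2 * ((2 * INR N + 1) * w (S k))) by ring.
  apply Rmult_le_compat_l; [apply pow2_ge_0|].
  apply growth_gap, Hg; lia.
Qed.

(* Discrete integration by parts: the sum is [sum_{k<n} ((k+1) beta_k^2 -
   k beta_{k+1}^2) a_k a_{k+1}] plus the boundary term, and each summand is
   controlled by [beta_gap] and AM-GM. *)
Lemma energy_bound (N : nat) (w : nat -> R) (a : nat -> R) (n : nat) :
  weight_sequence w -> polynomial_growth N w ->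
  sum_n (fun k => beta w k ^ 2 * (a k * flow_coef a k)) n
  <= (2 * INR N + 1) * sum_n (fun k => beta w k ^ 2 * a k ^ 2) n
     + INR (n + 1) * beta w n ^ 2 * (a n * a (S n)).
Proof.
  intros Hw Hg; pose proof (pos_INR N) as HN.
  (* AM-GM on the pair [(k, k+1)] spends half of the square at each end. The strengthened claim
     keeps the unspent half of the last square in reserve for the next pair. *)
  enough (H : sum_n (fun k => beta w k ^ 2 * (a k * flow_coef a k)) n
  <= (2 * INR N + 1) * sum_n (fun k => beta w k ^ 2 * a k ^ 2) n
     - (2 * INR N + 1) / 2 * (beta w n ^ 2 * a n ^ 2)
     + INR (n + 1) * beta w n ^ 2 * (a n * a (S n))).
  { assert (0 <= (2 * INR N + 1) / 2 * (beta w n ^ 2 * a n ^ 2)); [|lra].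
    apply Rmult_le_pos; [lra|]; apply Rmult_le_pos; apply pow2_ge_0. }
  induction n as [|n IH].
  - rewrite !sum_O; unfold flow_coef; simpl.
    pose proof (pow2_ge_0 (a 0%nat)); nra.
  - rewrite !sum_Sn_R.
    eapply Rle_trans; [apply Rplus_le_compat_r, IH|]; clear IH.
    unfold flow_coef.
    pose proof (beta_gap N w n Hw Hg) as Hgap.
    pose proof (beta_pos w Hw n) as Hb; pose proof (beta_pos w Hw (S n)) as Hb'.
    set (b := beta w n) in *; set (b' := beta w (S n)) in *.
    set (x := a n) in *; set (y := a (S n)) in *.
    set (g := INR (n + 1) * b ^ 2 - INR n * b' ^ 2) in *.
    assert (H : g * (x * y) <= (2 * INR N + 1) / 2 * (b ^ 2 * x ^ 2 + b' ^ 2 * y ^ 2)).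
    { eapply Rle_trans; [apply Rle_abs|]; rewrite !Rabs_mult.
      eapply Rle_trans.
      { apply Rmult_le_compat_r; [|exact Hgap].
        apply Rmult_le_pos; apply Rabs_pos. }
      pose proof (pow2_ge_0 (b * Rabs x - b' * Rabs y)).
      rewrite <- (pow2_abs x), <- (pow2_abs y); nra. }
    unfold g in H; lra.
Qed.

(** Ratio test: since [w] tends to 1, consecutive terms have ratio tending to [q^2 < 1]. *)
Lemma boundary_lim (w : nat -> R) (q : R) : weight_sequence w -> 0 < q < 1 ->
  is_lim_seq (fun n => INR (n + 1) * beta w n ^ 2 * (q ^ n * q ^ n)) 0.
Proof.
  intros Hw Hq.
  apply is_lim_seq_abs_0.
  apply ex_series_lim_0, (ex_series_DAlembert _ (q * q)); [nra| |].
  - intros n; pose proof (beta_pos w Hw n).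
    assert (0 < q ^ n) by (apply pow_lt; lra).
    assert (0 < INR (n + 1)) by (apply lt_0_INR; lia).
    apply Rgt_not_eq; repeat apply Rmult_lt_0_compat; auto; lra.
  - apply is_lim_seq_ext with
      (fun n => (1 + / INR (n + 1)) * (w (S n) * w (S n)) * (q * q)).
    { intros n; pose proof (beta_pos w Hw n).
      assert (0 < q ^ n) by (apply pow_lt; lra).
      assert (0 < INR (n + 1)) by (apply lt_0_INR; lia).
      assert (0 < w (S n)) by (apply Hw; lia).
      replace (INR (S n + 1)) with (INR (n + 1) + 1) by (rewrite <- S_INR; reflexivity).
      rewrite Rabs_pos_eq.
      - simpl; field; repeat split; lra.
      - apply Rlt_le, Rdiv_lt_0_compat.
        + pose proof (beta_pos w Hw (S n)). simpl pow.
          repeat apply Rmult_lt_0_compat; try lra.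
        + simpl pow. repeat apply Rmult_lt_0_compat; try lra. }
    replace (Finite (q * q)) with (Finite ((1 + 0) * (1 * 1) * (q * q)))
      by (f_equal; ring).
    assert (Hw1 : is_lim_seq (fun n => w (S n)) 1).
    { apply (is_lim_seq_incr_1 w), Hw. }
    apply is_lim_seq_mult'; [apply is_lim_seq_mult'|apply is_lim_seq_const].
    + apply is_lim_seq_plus'; [apply is_lim_seq_const|].
      replace (Finite 0) with (Rbar_inv p_infty) by reflexivity.
      apply is_lim_seq_inv; [|discriminate].
      apply (is_lim_seq_incr_n INR 1), is_lim_seq_INR.
    + now apply is_lim_seq_mult'.
Qed.

(** * Gronwall's inequality for polynomials *)

Lemma sum_n_mult_l_R (c : R) (f : nat -> R) n : sum_n (fun k => c * f k) n = c * sum_n f n.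
Proof. exact (sum_n_mult_l (K := R_Ring) c f n). Qed.

Lemma sum_n_le_R (f g : nat -> R) n :
  (forall k, (k <= n)%nat -> f k <= g k) -> sum_n f n <= sum_n g n.
Proof.
  intros H; induction n as [|n IH].
  - rewrite !sum_O; apply H; lia.
  - rewrite !sum_Sn_R; apply Rplus_le_compat; [apply IH; intros; apply H|apply H]; lia.
Qed.

Lemma sum_n_nonneg (f : nat -> R) n : (forall k, 0 <= f k) -> 0 <= sum_n f n.
Proof.
  intros H; rewrite <- (Rmult_0_l (sum_n f n)), <- sum_n_mult_l_R.
  apply sum_n_le_R; intros k _; rewrite Rmult_0_l; apply H.
Qed.

Lemma sum_n_le_index (f : nat -> R) n m :
  (forall k, 0 <= f k) -> (n <= m)%nat -> sum_n f n <= sum_n f m.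
Proof.
  intros H Hnm; induction Hnm; [lra|].
  rewrite sum_Sn_R; specialize (H (S m)); lra.
Qed.

(** The coefficient of [u^k] in [P (mobius s u)], where [P] is the polynomial of degree at most [M]
    with coefficients [p]. *)
Definition image_coef (p : nat -> R) (M : nat) (s : R) (k : nat) : R :=
  sum_n (fun m => p m * mobius_coef s m k) M.

Lemma image_coef_flow (p : nat -> R) (M : nat) (s : R) (k : nat) :
  flow_coef (image_coef p M s) k = sum_n (fun m => p m * flow_coef (mobius_coef s m) k) M.
Proof.
  unfold image_coef; induction M as [|M IH].
  - rewrite sum_O; unfold flow_coef; rewrite sum_O.
    destruct k as [|k]; [|rewrite sum_O]; ring.
  - rewrite sum_Sn_R, <- IH; unfold flow_coef; rewrite sum_Sn_R.
    destruct k as [|k]; [|rewrite sum_Sn_R]; ring.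
Qed.

Lemma image_coef_derive (p : nat -> R) (M k : nat) (s : R) : -1 < s < 1 ->
  is_derive (fun s => image_coef p M s k) s
    (flow_coef (image_coef p M s) k / (1 - s ^ 2)).
Proof.
  intros Hs; unfold Rdiv; rewrite Rmult_comm, image_coef_flow, <- sum_n_mult_l_R.
  apply (is_derive_sum_n (fun m s => p m * mobius_coef s m k)); intros m _.
  evar_last; [apply is_derive_scal, mobius_coef_derive, Hs|].
  simpl; unfold Rdiv; ring.
Qed.

Lemma image_coef_decay (p : nat -> R) (M : nat) (q s0 : R) : 0 < q < 1 -> 0 <= s0 < q ->
  exists A, 0 <= A /\
    forall s k, 0 <= s <= s0 -> Rabs (image_coef p M s k) <= A * q ^ k.
Proof.
  intros Hq Hs0; unfold image_coef; induction M as [|M [A [HA IH]]].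
  - destruct (mobius_coef_decay q 0 Hq s0 Hs0) as [A [HA H]].
    exists (Rabs (p O) * A); split.
    { apply Rmult_le_pos; auto; apply Rabs_pos. }
    intros s k Hs; rewrite sum_O, Rabs_mult, Rmult_assoc.
    apply Rmult_le_compat_l; [apply Rabs_pos | auto].
  - destruct (mobius_coef_decay q (S M) Hq s0 Hs0) as [A' [HA' H]].
    exists (A + Rabs (p (S M)) * A'); split.
    { apply Rplus_le_le_0_compat; auto; apply Rmult_le_pos; auto; apply Rabs_pos. }
    intros s k Hs; rewrite sum_Sn_R; eapply Rle_trans; [apply Rabs_triang|].
    rewrite Rmult_plus_distr_r; apply Rplus_le_compat; [auto|].
    rewrite Rabs_mult, Rmult_assoc.
    apply Rmult_le_compat_l; [apply Rabs_pos | auto].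
Qed.

Lemma image_coef_at_0 (p : nat -> R) (M k : nat) :
  image_coef p M 0 k = if le_dec k M then p k else 0.
Proof.
  unfold image_coef; induction M as [|M IH].
  - rewrite sum_O, mobius_coef_at_0.
    destruct (Nat.eq_dec 0 k), (le_dec k 0); subst; try lia; ring.
  - rewrite sum_Sn_R, IH, mobius_coef_at_0.
    destruct (Nat.eq_dec (S M) k), (le_dec k M), (le_dec k (S M)); subst; try lia; ring.
Qed.

(** The solution of [y' = 2 (2N + 1) / (1 - s^2) y] with [y 0 = 1]. *)
Definition growth_factor (N : nat) (s : R) : R := ((1 + s) / (1 - s)) ^ (2 * N + 1).

Lemma growth_factor_pos N s : 0 <= s < 1 -> 0 < growth_factor N s.
Proof. intros; apply pow_lt, Rdiv_lt_0_compat; lra. Qed.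

Definition partial_energy (w : nat -> R) (a : nat -> R) (n : nat) : R :=
  sum_n (fun k => beta w k ^ 2 * a k ^ 2) n.

Lemma partial_energy_at_0 w p M n :
  partial_energy w (image_coef p M 0) n <= partial_energy w p M.
Proof.
  assert (Hp : forall a k, 0 <= beta w k ^ 2 * a k ^ 2).
  { intros; apply Rmult_le_pos; apply pow2_ge_0. }
  unfold partial_energy; eapply Rle_trans.
  { apply (sum_n_le_index _ n (max n M)); [apply Hp | lia]. }
  induction (max n M) as [|j IH].
  - rewrite sum_O, image_coef_at_0.
    destruct (le_dec 0 M); [|lia].
    rewrite <- (sum_O (fun k => beta w k ^ 2 * p k ^ 2)).
    apply sum_n_le_index; [apply Hp | lia].
  - destruct (le_dec (S j) M) as [Hj|Hj].
    + apply Rle_trans with (sum_n (fun k => beta w k ^ 2 * p k ^ 2) (S j)).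
      * apply sum_n_le_R; intros k Hk; rewrite image_coef_at_0.
        destruct (le_dec k M); [lra|lia].
      * apply sum_n_le_index; [apply Hp | lia].
    + rewrite sum_Sn_R, image_coef_at_0.
      destruct (le_dec (S j) M); [lia|]; lra.
Qed.

Lemma partial_energy_derive w p M n s : -1 < s < 1 ->
  is_derive (fun s => partial_energy w (image_coef p M s) n) s
    (2 / (1 - s ^ 2) * sum_n (fun k => beta w k ^ 2 *
        (image_coef p M s k * flow_coef (image_coef p M s) k)) n).
Proof.
  intros Hs; rewrite <- sum_n_mult_l_R.
  apply (is_derive_sum_n (fun k s => beta w k ^ 2 * image_coef p M s k ^ 2)).
  intros k _; evar_last.
  - apply is_derive_scal, is_derive_pow, image_coef_derive, Hs.
  - simpl; unfold Rdiv; ring.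
Qed.

(** The integrating factor of the Gronwall argument: with [S P = 2N + 1] it is the inverse of
    [growth_factor N s]. *)
Lemma weighted_energy_derive (P : nat) (f : R -> R) (s df : R) : -1 < s < 1 ->
  is_derive f s df ->
  is_derive (fun s => ((1 - s) / (1 + s)) ^ S P * f s) s
    (((1 - s) / (1 + s)) ^ S P * (df - 2 * INR (S P) / (1 - s ^ 2) * f s)).
Proof.
  intros Hs Hf.
  assert (Hy : is_derive (fun s => (1 - s) / (1 + s)) s (- 2 / (1 + s) ^ 2)).
  { auto_derive; [lra | field; lra]. }
  evar_last.
  - apply (is_derive_mult (fun s => ((1 - s) / (1 + s)) ^ S P) f);
      [apply (is_derive_pow _ (S P)), Hy | exact Hf | intros; apply Rmult_comm].
  - unfold plus, mult; simpl Hierarchy.plus; simpl Hierarchy.mult.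
    change (INR (S P) * (-2 / (1 + s) ^ 2) * ((1 - s) / (1 + s)) ^ P * f s
            + ((1 - s) / (1 + s)) ^ S P * df
            = ((1 - s) / (1 + s)) ^ S P * (df - 2 * INR (S P) / (1 - s ^ 2) * f s)).
    rewrite <- (tech_pow_Rmult ((1 - s) / (1 + s)) P).
    generalize (((1 - s) / (1 + s)) ^ P) (INR (S P)); intros; field; split; nra.
Qed.

(** Gronwall with an error: multiplied by the integrating factor, the truncated energy has
    derivative at most [eps], the boundary term of [energy_bound] estimated by the decay hypothesis.
    The mean value theorem then replaces integration. *)
Lemma partial_energy_growth (N : nat) (w p : nat -> R) (M n : nat) (s0 A q : R) :
  weight_sequence w -> polynomial_growth N w -> 0 <= s0 < q -> q < 1 -> 0 <= A ->
  (forall s k, 0 <= s <= s0 -> Rabs (image_coef p M s k) <= A * q ^ k) ->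
  partial_energy w (image_coef p M s0) n
  <= growth_factor N s0 * (partial_energy w p M
     + 2 / (1 - s0 ^ 2) * A ^ 2 * (INR (n + 1) * beta w n ^ 2 * (q ^ n * q ^ n))).
Proof.
  intros Hw Hg Hs0 Hq HA Hdec.
  set (eps := 2 / (1 - s0 ^ 2) * A ^ 2 * (INR (n + 1) * beta w n ^ 2 * (q ^ n * q ^ n))).
  set (E := fun s => partial_energy w (image_coef p M s) n).
  set (P := (2 * N)%nat).
  set (dE := fun s => 2 / (1 - s ^ 2) * sum_n (fun k => beta w k ^ 2 *
        (image_coef p M s k * flow_coef (image_coef p M s) k)) n).
  set (H := fun s => ((1 - s) / (1 + s)) ^ S P * E s).
  set (dH := fun s => ((1 - s) / (1 + s)) ^ S P * (dE s - 2 * INR (S P) / (1 - s ^ 2) * E s)).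
  assert (HdH : forall s, 0 <= s <= s0 -> is_derive H s (dH s)).
  { intros s Hs; apply weighted_energy_derive; [lra|].
    apply partial_energy_derive; lra. }
  assert (Hpos : 0 <= INR (n + 1) * beta w n ^ 2) by
    (apply Rmult_le_pos; [apply pos_INR | apply pow2_ge_0]).
  assert (Heps : 0 <= eps).
  { unfold eps; apply Rmult_le_pos.
    - apply Rmult_le_pos; [|apply pow2_ge_0].
      apply Rlt_le, Rdiv_lt_0_compat; nra.
    - apply Rmult_le_pos; [exact Hpos|].
      apply Rle_0_sqr. }
  assert (Hle : forall s, 0 <= s <= s0 -> dH s <= eps).
  { intros s Hs.
    assert (Hin : dE s - 2 * INR (S P) / (1 - s ^ 2) * E s <= eps).
    { pose proof (energy_bound N w (image_coef p M s) n Hw Hg) as HE.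
      set (T := sum_n _ n) in HE.
      replace (sum_n _ n) with (E s) in HE by reflexivity.
      unfold dE; fold T.
      assert (Hs2 : 0 < 1 - s ^ 2) by nra.
      assert (Hs02 : 0 < 1 - s0 ^ 2) by nra.
      apply Rle_trans with (2 / (1 - s ^ 2) * (INR (n + 1) * beta w n ^ 2 *
        (image_coef p M s n * image_coef p M s (S n)))).
      - replace (INR (S P)) with (2 * INR N + 1)
          by (unfold P; rewrite S_INR, mult_INR; simpl; ring).
        unfold Rdiv; rewrite (Rmult_assoc 2 (_ + _) _), (Rmult_comm (2 * INR N + 1)).
        assert (0 < 2 * / (1 - s ^ 2)).
        { apply Rmult_lt_0_compat; [lra | now apply Rinv_0_lt_compat]. }
        nra.
      - assert (Hqn : 0 <= q ^ n) by (apply pow_le; lra).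
        assert (HX : image_coef p M s n * image_coef p M s (S n)
                     <= A ^ 2 * (q ^ n * q ^ n)).
        { eapply Rle_trans; [apply Rle_abs|]; rewrite Rabs_mult.
          pose proof (Hdec s n Hs) as H1; pose proof (Hdec s (S n) Hs) as H2.
          assert (A * q ^ S n <= A * q ^ n).
          { apply Rmult_le_compat_l; [exact HA|]; simpl; nra. }
          replace (A ^ 2 * (q ^ n * q ^ n)) with ((A * q ^ n) * (A * q ^ n)) by ring.
          apply Rmult_le_compat; try apply Rabs_pos; lra. }
        assert (Hc : 2 / (1 - s ^ 2) <= 2 / (1 - s0 ^ 2)).
        { apply Rmult_le_compat_l; [lra|]; apply Rinv_le_contravar; nra. }
        assert (Hc0 : 0 < 2 / (1 - s ^ 2)) by (apply Rdiv_lt_0_compat; lra).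
        assert (HY : 0 <= INR (n + 1) * beta w n ^ 2 * (A ^ 2 * (q ^ n * q ^ n))).
        { apply Rmult_le_pos; [exact Hpos|]; apply Rmult_le_pos; [apply pow2_ge_0|nra]. }
        apply Rle_trans with
          (2 / (1 - s ^ 2) * (INR (n + 1) * beta w n ^ 2 * (A ^ 2 * (q ^ n * q ^ n)))).
        + apply Rmult_le_compat_l; [lra|]; now apply Rmult_le_compat_l.
        + replace eps with
            (2 / (1 - s0 ^ 2) * (INR (n + 1) * beta w n ^ 2 * (A ^ 2 * (q ^ n * q ^ n))))
            by (unfold eps; ring).
          now apply Rmult_le_compat_r. }
    unfold dH.
    (* The integrating factor lies in [[0, 1]] and [eps] is nonnegative, so multiplying by it
       preserves the bound [eps]. *)
    assert (Hy : 0 <= (1 - s) / (1 + s) <= 1).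
    { split; [apply Rlt_le, Rdiv_lt_0_compat; lra | apply Rle_div_l; lra]. }
    assert (0 <= ((1 - s) / (1 + s)) ^ S P <= 1).
    { split; [apply pow_le; lra|].
      apply Rle_trans with (1 ^ S P); [apply pow_incr; lra | rewrite pow1; lra]. }
    nra. }
  destruct (MVT_gen H 0 s0 dH) as [c [Hc HM]].
  { rewrite Rmin_left, Rmax_right by lra; intros x Hx; apply HdH; lra. }
  { rewrite Rmin_left, Rmax_right by lra; intros x Hx.
    apply continuity_pt_filterlim, (ex_derive_continuous (V := R_NormedModule)).
    eexists; apply HdH; lra. }
  rewrite Rmin_left, Rmax_right in Hc by lra.
  specialize (Hle c Hc).
  assert (HE0 : H 0 <= partial_energy w p M).
  { unfold H; replace ((1 - 0) / (1 + 0)) with 1 by field; rewrite pow1, Rmult_1_l.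
    apply partial_energy_at_0. }
  (* The interval has length [s0 < 1], so the increment of [H] is at most [eps]. *)
  assert (HE : H s0 <= partial_energy w p M + eps) by nra.
  replace (partial_energy w (image_coef p M s0) n) with (growth_factor N s0 * H s0).
  - apply Rmult_le_compat_l; [apply Rlt_le, growth_factor_pos; lra | exact HE].
  - unfold H, growth_factor, E, P; rewrite <- Rmult_assoc, Nat.add_1_r, <- Rpow_mult_distr.
    replace ((1 + s0) / (1 - s0) * _) with 1 by (field; lra).
    rewrite pow1; ring.
Qed.

(** Moving the truncation to [m + n] only enlarges the left side, while the error term on the right
    tends to 0 as [m] grows. Any [q] strictly between [s] and 1 serves; the midpoint is taken. *)
Lemma partial_energy_bound (N : nat) (w p : nat -> R) (M n : nat) (s : R) :
  weight_sequence w -> polynomial_growth N w -> 0 <= s < 1 ->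
  partial_energy w (image_coef p M s) n <= growth_factor N s * partial_energy w p M.
Proof.
  intros Hw Hg Hs.
  set (q := (s + 1) / 2).
  assert (Hq : 0 < q < 1) by (unfold q; lra).
  assert (Hsq : 0 <= s < q) by (unfold q; lra).
  destruct (image_coef_decay p M q s Hq Hsq) as [A [HA Hdec]].
  pose proof (boundary_lim w q Hw Hq) as Hlim.
  apply (is_lim_seq_scal_l _ (2 / (1 - s ^ 2) * A ^ 2)) in Hlim.
  rewrite Rbar_mult_0_r in Hlim.
  apply (is_lim_seq_plus' (fun _ => partial_energy w p M) _ _ 0 (is_lim_seq_const _)) in Hlim.
  apply (is_lim_seq_scal_l _ (growth_factor N s)) in Hlim.
  simpl Rbar_mult in Hlim; rewrite Rplus_0_r in Hlim.
  apply (is_lim_seq_incr_n _ n) in Hlim.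
  refine (is_lim_seq_le _ _ _ _ _ (is_lim_seq_const _) Hlim); intros m.
  eapply Rle_trans; [|apply partial_energy_growth with (q := q); eauto; lra].
  apply sum_n_le_index; [|lia].
  intros k; apply Rmult_le_pos; apply pow2_ge_0.
Qed.

(** * Square-summable sequences *)

Lemma sum_n_ext_R (f g : nat -> R) n : (forall k, f k = g k) -> sum_n f n = sum_n g n.
Proof. exact (sum_n_ext f g n). Qed.

Lemma partial_energy_term_nonneg (w a : nat -> R) (k : nat) : 0 <= beta w k ^ 2 * a k ^ 2.
Proof. apply Rmult_le_pos; apply pow2_ge_0. Qed.

Lemma sum_n_le_Series (f : nat -> R) n : (forall k, 0 <= f k) -> ex_series f ->
  sum_n f n <= Series f.
Proof.
  intros Hf Hex.
  refine (is_lim_seq_le (fun _ => sum_n f n) (fun m => sum_n f (m + n)) _ (Series f) _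
    (is_lim_seq_const _) _).
  - intros m; apply sum_n_le_index; [exact Hf | lia].
  - apply (is_lim_seq_incr_n (sum_n f) n), (Series_correct f Hex).
Qed.

Lemma nonneg_series_bounded (f : nat -> R) B : (forall k, 0 <= f k) ->
  (forall n, sum_n f n <= B) -> ex_series f /\ Series f <= B.
Proof.
  intros Hf HB.
  assert (Hex : ex_series f).
  { destruct (ex_finite_lim_seq_incr (sum_n f) B) as [l Hl]; [|exact HB|now exists l].
    intros n; apply sum_n_le_index; [exact Hf | lia]. }
  split; [exact Hex|].
  exact (is_lim_seq_le (sum_n f) (fun _ => B) (Series f) B HB (Series_correct f Hex)
    (is_lim_seq_const B)).
Qed.

(* Testing [partial_energy_bound] on [p m = mobius_coef s m k / beta_m^2]. *)
Lemma mobius_coef_column_bound (N : nat) (w : nat -> R) (k M : nat) (s : R) :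
  weight_sequence w -> polynomial_growth N w -> 0 <= s < 1 ->
  sum_n (fun m => mobius_coef s m k ^ 2 / beta w m ^ 2) M
  <= growth_factor N s / beta w k ^ 2.
Proof.
  intros Hw Hg Hs.
  set (p := fun m => mobius_coef s m k / beta w m ^ 2).
  set (X := sum_n _ M).
  assert (Hb : forall m, 0 < beta w m ^ 2) by (intros m; apply pow_lt, beta_pos, Hw).
  assert (H1 : image_coef p M s k = X).
  { apply sum_n_ext_R; intros m; unfold p; field.
    apply Rgt_not_eq, beta_pos, Hw. }
  assert (H2 : partial_energy w p M = X).
  { apply sum_n_ext_R; intros m; unfold p; field.
    apply Rgt_not_eq, beta_pos, Hw. }
  assert (HX : 0 <= X).
  { apply sum_n_nonneg; intros m; apply Rmult_le_pos; [apply pow2_ge_0|].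
    apply Rlt_le, Rinv_0_lt_compat, Hb. }
  (* For this [p] both the energy and the [k]-th coefficient of the image equal [X]; keeping only
     the [k]-th term of the image energy gives an inequality quadratic in [X] against a linear
     one. *)
  assert (H3 : beta w k ^ 2 * X ^ 2 <= growth_factor N s * X).
  { rewrite <- H2 at 2; rewrite <- H1 at 1.
    eapply Rle_trans; [|apply (partial_energy_bound N w p M k s Hw Hg Hs)].
    unfold partial_energy; destruct k as [|k]; [rewrite sum_O; lra|rewrite sum_Sn_R].
    apply Rle_trans with (0 + beta w (S k) ^ 2 * image_coef p M s (S k) ^ 2); [lra|].
    apply Rplus_le_compat_r, sum_n_nonneg; intros j; apply partial_energy_term_nonneg. }
  apply Rle_div_r; [apply Hb|].
  specialize (Hb k); pose proof (growth_factor_pos N s Hs).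
  destruct HX as [HX| <-]; [|lra].
  apply Rmult_le_reg_l with X; [exact HX|]; lra.
Qed.

(** * Moebius images of sequences of finite energy *)

Definition energy (w a : nat -> R) : R := Series (fun k => beta w k ^ 2 * a k ^ 2).
Definition finite_energy (w a : nat -> R) : Prop := ex_series (fun k => beta w k ^ 2 * a k ^ 2).

Definition mobius_image (s : R) (a : nat -> R) (k : nat) : R :=
  Series (fun m => a m * mobius_coef s m k).

(** Each term is the product of [beta_m a_m] and [mobius_coef s m k / beta_m], both square-summable
    in [m], the latter by the column bound; [|x y| <= x^2 + y^2] concludes. *)
Lemma mobius_image_ex (N : nat) (w : nat -> R) (s : R) (a : nat -> R) (k : nat) :
  weight_sequence w -> polynomial_growth N w -> 0 <= s < 1 ->
  finite_energy w a ->
  ex_series (fun m => a m * mobius_coef s m k).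
Proof.
  intros Hw Hg Hs Ha.
  assert (Hb : forall m, 0 < beta w m) by (intros m; apply beta_pos, Hw).
  destruct (nonneg_series_bounded (fun m => mobius_coef s m k ^ 2 / beta w m ^ 2)
    (growth_factor N s / beta w k ^ 2)) as [Hc _].
  { intros m; apply Rmult_le_pos; [apply pow2_ge_0|].
    apply Rlt_le, Rinv_0_lt_compat, pow_lt, Hb. }
  { intros M; now apply mobius_coef_column_bound. }
  refine (ex_series_le (V := R_CompleteNormedModule) _ _ _ (ex_series_plus _ _ Ha Hc)).
  intros m; change (Rabs (a m * mobius_coef s m k)
    <= beta w m ^ 2 * a m ^ 2 + mobius_coef s m k ^ 2 / beta w m ^ 2).
  replace (a m * mobius_coef s m k)
    with ((beta w m * a m) * (mobius_coef s m k / beta w m))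
    by (field; apply Rgt_not_eq, Hb).
  replace (beta w m ^ 2 * a m ^ 2) with ((beta w m * a m) ^ 2) by ring.
  replace (mobius_coef s m k ^ 2 / beta w m ^ 2) with ((mobius_coef s m k / beta w m) ^ 2)
    by (field; apply Rgt_not_eq, Hb).
  generalize (beta w m * a m) (mobius_coef s m k / beta w m); intros x y.
  apply Rabs_le; split; nra.
Qed.

(** A Fatou argument: for fixed [n] only finitely many coefficients occur, each the limit of those
    of the polynomial truncations, and the bound on these is uniform in [M]. *)
Lemma partial_energy_mobius_image (N : nat) (w : nat -> R) (s : R) (a : nat -> R) (n : nat) :
  weight_sequence w -> polynomial_growth N w -> 0 <= s < 1 ->
  finite_energy w a ->
  partial_energy w (mobius_image s a) n <= growth_factor N s * energy w a.
Proof.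
  intros Hw Hg Hs Ha.
  assert (Hlim : is_lim_seq (fun M => partial_energy w (image_coef a M s) n)
                            (partial_energy w (mobius_image s a) n)).
  { assert (Hk : forall k, is_lim_seq (fun M => beta w k ^ 2 * image_coef a M s k ^ 2)
                                      (beta w k ^ 2 * mobius_image s a k ^ 2)).
    { intros k.
      assert (H : is_lim_seq (fun M => image_coef a M s k) (mobius_image s a k))
        by apply (Series_correct _ (mobius_image_ex N w s a k Hw Hg Hs Ha)).
      apply (is_lim_seq_scal_l _ (beta w k ^ 2) (mobius_image s a k ^ 2)).
      simpl pow; apply is_lim_seq_mult'; [exact H|].
      apply is_lim_seq_mult'; [exact H | apply is_lim_seq_const]. }
    unfold partial_energy; induction n as [|n IH].
    - rewrite sum_O.
      apply (is_lim_seq_ext (fun M => beta w 0 ^ 2 * image_coef a M s 0 ^ 2)); [|apply Hk].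
      intros M; now rewrite sum_O.
    - rewrite sum_Sn_R.
      eapply is_lim_seq_ext; [intros M; symmetry; apply sum_Sn_R|].
      now apply is_lim_seq_plus'. }
  refine (is_lim_seq_le _ _ _ _ _ Hlim (is_lim_seq_const _)); intros M.
  eapply Rle_trans; [now apply (partial_energy_bound N)|].
  apply Rmult_le_compat_l; [now apply Rlt_le, growth_factor_pos|].
  apply sum_n_le_Series; [apply partial_energy_term_nonneg | exact Ha].
Qed.

(** The difference is itself the image of the tail [a'] of [a] beyond [M], so the energy bound
    applies to it. The right side does not depend on [k], which gives the uniformity that
    [mobius_image_C_pseries] relies on. *)
Lemma mobius_image_tail (N : nat) (w : nat -> R) (s : R) (a : nat -> R) (M k : nat) :
  weight_sequence w -> polynomial_growth N w -> 0 <= s < 1 ->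
  finite_energy w a ->
  beta w k ^ 2 * (mobius_image s a k - image_coef a M s k) ^ 2
  <= growth_factor N s * (energy w a - partial_energy w a M).
Proof.
  intros Hw Hg Hs Ha.
  set (a' := fun m => if le_dec m M then 0 else a m).
  assert (Htail : forall f g : nat -> R,
    (forall m, (m <= M)%nat -> g m = 0) -> (forall m, ~ (m <= M)%nat -> g m = f m) ->
    ex_series f -> ex_series g /\ Series g = Series f - sum_n f M).
  { intros f g H0 H1 Hf.
    assert (Hg' : is_lim_seq (sum_n g) (Series f - sum_n f M)); [|split; [eexists; exact Hg' | apply is_series_unique; exact Hg']].
    assert (Hsum : forall n, sum_n f (n + S M) - sum_n f M = sum_n g (n + S M)).
    { assert (H : forall n, (n <= M)%nat -> sum_n g n = 0).
      { intros n Hn; rewrite <- (sum_n_ext_loc (fun _ => 0 : R)).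
        - now rewrite sum_n_const, Rmult_0_r.
        - intros j Hj; symmetry; apply H0; lia. }
      induction n as [|n IH]; simpl Nat.add; rewrite !sum_Sn_R.
      - rewrite H, H1 by lia; ring.
      - rewrite <- IH, H1 by lia; ring. }
    apply <- (is_lim_seq_incr_n (sum_n g) (S M)).
    eapply is_lim_seq_ext; [exact Hsum|].
    apply is_lim_seq_minus'; [|apply is_lim_seq_const].
    apply (is_lim_seq_incr_n (sum_n f) (S M)), (Series_correct f Hf). }
  assert (Hin : forall m, (m <= M)%nat -> a' m = 0)
    by (intros m Hm; unfold a'; destruct (le_dec m M); [reflexivity | lia]).
  assert (Hout : forall m, ~ (m <= M)%nat -> a' m = a m)
    by (intros m Hm; unfold a'; destruct (le_dec m M); [lia | reflexivity]).
  destruct (Htail (fun m => beta w m ^ 2 * a m ^ 2) (fun m => beta w m ^ 2 * a' m ^ 2))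
    as [Hex HE]; [| |exact Ha|].
  { intros m Hm; rewrite Hin by exact Hm; ring. }
  { intros m Hm; now rewrite Hout. }
  destruct (Htail (fun m => a m * mobius_coef s m k) (fun m => a' m * mobius_coef s m k))
    as [_ HI]; [| |now apply (mobius_image_ex N w)|].
  { intros m Hm; rewrite Hin by exact Hm; ring. }
  { intros m Hm; now rewrite Hout. }
  change (mobius_image s a' k = mobius_image s a k - image_coef a M s k) in HI.
  change (energy w a' = energy w a - partial_energy w a M) in HE.
  rewrite <- HI, <- HE.
  eapply Rle_trans; [|apply (partial_energy_mobius_image N w s a' k Hw Hg Hs Hex)].
  unfold partial_energy; destruct k as [|k]; [rewrite sum_O; lra|rewrite sum_Sn_R].
  apply Rle_trans with (0 + beta w (S k) ^ 2 * mobius_image s a' (S k) ^ 2); [lra|].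
  apply Rplus_le_compat_r, sum_n_nonneg; intros j; apply partial_energy_term_nonneg.
Qed.

Lemma mobius_image_energy (N : nat) (w : nat -> R) (s : R) (a : nat -> R) :
  weight_sequence w -> polynomial_growth N w -> 0 <= s < 1 ->
  finite_energy w a ->
  finite_energy w (mobius_image s a) /\ energy w (mobius_image s a) <= growth_factor N s * energy w a.
Proof.
  intros Hw Hg Hs Ha; apply nonneg_series_bounded; [apply partial_energy_term_nonneg|].
  intros n; now apply (partial_energy_mobius_image N).
Qed.

(** * Complex power series *)

Lemma sum_Sn_C (f : nat -> C) n : sum_n f (S n) = (sum_n f n + f (S n))%C.
Proof. exact (sum_Sn f n). Qed.

Lemma sum_n_ext_C (f g : nat -> C) n : (forall k, f k = g k) -> sum_n f n = sum_n g n.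
Proof. exact (sum_n_ext f g n). Qed.

Lemma Re_sum_n (f : nat -> C) n : Re (sum_n f n) = sum_n (fun k => Re (f k)) n.
Proof.
  induction n as [|n IH]; [now rewrite !sum_O|].
  rewrite sum_Sn_C, sum_Sn_R, <- IH; reflexivity.
Qed.

Lemma Im_sum_n (f : nat -> C) n : Im (sum_n f n) = sum_n (fun k => Im (f k)) n.
Proof.
  induction n as [|n IH]; [now rewrite !sum_O|].
  rewrite sum_Sn_C, sum_Sn_R, <- IH; reflexivity.
Qed.

Lemma Cmod_sum_n_le (f : nat -> C) (g : nat -> R) n :
  (forall k, Cmod (f k) <= g k) -> Cmod (sum_n f n) <= sum_n g n.
Proof.
  intros H; induction n as [|n IH]; [rewrite !sum_O; apply H|].
  rewrite sum_Sn_C, sum_Sn_R; eapply Rle_trans; [apply Cmod_triangle|].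
  now apply Rplus_le_compat.
Qed.

Lemma pow_n_Cpow (z : C) k : pow_n (K := C_Ring) z k = (z ^ k)%C.
Proof. induction k as [|k IH]; [reflexivity|]; simpl; now rewrite IH. Qed.

(** Turns complex convergence into a real null sequence, so that squeezing and limit arithmetic over
    the reals apply. *)
Lemma is_pseries_C (a : nat -> C) (z l : C) :
  is_pseries (K := C_AbsRing) (V := C_NormedModule) a z l <->
  is_lim_seq (fun n => Cmod (sum_n (fun k => z ^ k * a k)%C n - l)%C) 0.
Proof.
  assert (Hsum : forall n, sum_n (fun k => scal (pow_n (K := C_Ring) z k) (a k : C_NormedModule)) n
                           = sum_n (fun k => z ^ k * a k)%C n).
  { intros n; apply sum_n_ext; intros k; now rewrite pow_n_Cpow. }
  unfold is_pseries, is_series.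
  rewrite <- (is_lim_seq_spec _ 0).
  rewrite (filterlim_locally_ball_norm (U := C_NormedModule)).
  split; intros H eps; specialize (H eps); revert H; apply filter_imp; intros n.
  - intros H; change (Cmod (sum_n (fun k => scal (pow_n (K := C_Ring) z k) (a k : C_NormedModule)) n - l)%C < eps) in H.
    rewrite Rminus_0_r, Rabs_pos_eq by apply Cmod_ge_0.
    rewrite <- Hsum; exact H.
  - intros H; rewrite Rminus_0_r, Rabs_pos_eq in H by apply Cmod_ge_0.
    rewrite <- Hsum in H; exact H.
Qed.

Lemma is_lim_seq_0_le (u v : nat -> R) :
  (forall n, 0 <= u n <= v n) -> is_lim_seq v 0 -> is_lim_seq u 0.
Proof.
  intros H Hv; exact (is_lim_seq_le_le (fun _ => 0) u v 0 H (is_lim_seq_const 0) Hv).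
Qed.

Lemma real_power_series_unique (f g : nat -> R) :
  (forall x, Rabs x < 1 -> exists l, is_pseries f x l /\ is_pseries g x l) ->
  forall k, f k = g k.
Proof.
  intros H k.
  (* Convergence at [1 / 2] forces the terms there to tend to 0, which fails outside the disk of
     convergence; so the radius is positive. *)
  assert (Hr : forall h : nat -> R, ex_pseries h (1 / 2) -> Rbar_lt 0 (CV_radius h)).
  { intros h Hh; apply Rbar_not_le_lt; intros Hle.
    apply (CV_disk_outside h (1 / 2)).
    - apply Rbar_le_lt_trans with 0; [exact Hle|].
      simpl; rewrite Rabs_pos_eq; lra.
    - apply ex_series_lim_0 in Hh.
      eapply is_lim_seq_ext; [|exact Hh].
      intros n; simpl; rewrite pow_n_pow; apply Rmult_comm. }
  destruct (H (1 / 2)) as [l [Hf Hg]]; [rewrite Rabs_pos_eq; lra|].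
  apply PSeries_ext_recip.
  - apply Hr; now exists l.
  - apply Hr; now exists l.
  - exists (mkposreal 1 Rlt_0_1); intros x Hx.
    change (Rabs (x - 0) < 1) in Hx; rewrite Rminus_0_r in Hx.
    destruct (H x Hx) as [l' [Hf' Hg']].
    now rewrite (is_pseries_unique _ _ _ Hf'), (is_pseries_unique _ _ _ Hg').
Qed.

(** Restricting to real points and separating real and imaginary parts reduces this to real power
    series. It identifies the sequence chosen by [fhat] with one that has been computed. *)
Lemma power_series_unique (f : C -> C) (a b : nat -> C) :
  power_series_on_disk f a -> power_series_on_disk f b -> forall k, a k = b k.
Proof.
  intros Ha Hb.
  assert (Hre : forall c (x : R) l,
    is_pseries (K := C_AbsRing) (V := C_NormedModule) c (RtoC x) l ->
    is_pseries (fun k => Re (c k)) x (Re l) /\ is_pseries (fun k => Im (c k)) x (Im l)).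
  { intros c x l Hc; apply is_pseries_C in Hc.
    assert (Hx : forall k, (RtoC x ^ k)%C = RtoC (x ^ k)).
    { induction k as [|k IH]; [reflexivity|].
      rewrite Cpow_S, IH, <- RtoC_mult; reflexivity. }
    assert (Hlim : forall u : nat -> R, forall v : R,
      (forall n, Rabs (u n - v) <= Cmod (sum_n (fun k => RtoC x ^ k * c k)%C n - l)%C) ->
      is_lim_seq u v).
    { intros u v Huv.
      apply is_lim_seq_ext with (fun n => u n - v + v); [intros n; ring|].
      replace (Finite v) with (Finite (0 + v)) by (f_equal; ring).
      apply is_lim_seq_plus'; [|apply is_lim_seq_const].
      apply is_lim_seq_abs_0, (is_lim_seq_0_le _ _ (fun n => conj (Rabs_pos _) (Huv n)) Hc). }
    assert (Him : forall y : C, Rabs (Im y) <= Cmod y).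
    { intros y; eapply Rle_trans; [apply Rmax_r | apply Rmax_Cmod]. }
    split; apply (Hlim (sum_n _)); intros n.
    - eapply Rle_trans; [right | apply re_le_Cmod]; f_equal.
      transitivity (Re (sum_n (fun k => RtoC x ^ k * c k)%C n) - Re l); [|reflexivity].
      rewrite Re_sum_n; f_equal; apply sum_n_ext_R; intros k.
      rewrite Hx, pow_n_pow.
      change (x ^ k * Re (c k) = Re (RtoC (x ^ k) * c k)%C); unfold Re; simpl; ring.
    - eapply Rle_trans; [right | apply Him]; f_equal.
      transitivity (Im (sum_n (fun k => RtoC x ^ k * c k)%C n) - Im l); [|reflexivity].
      rewrite Im_sum_n; f_equal; apply sum_n_ext_R; intros k.
      rewrite Hx, pow_n_pow.
      change (x ^ k * Im (c k) = Im (RtoC (x ^ k) * c k)%C); unfold Im; simpl; ring. }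
  intros k.
  assert (H : forall x : R, Rabs x < 1 -> in_disk (RtoC x))
    by (intros x Hx; unfold in_disk; now rewrite Cmod_R).
  rewrite (surjective_pairing (a k)), (surjective_pairing (b k)); f_equal.
  - apply (real_power_series_unique (fun k => Re (a k)) (fun k => Re (b k))); intros x Hx.
    exists (Re (f x)); split; [apply (Hre a), Ha | apply (Hre b), Hb]; auto.
  - apply (real_power_series_unique (fun k => Im (a k)) (fun k => Im (b k))); intros x Hx.
    exists (Im (f x)); split; [apply (Hre a), Ha | apply (Hre b), Hb]; auto.
Qed.

Lemma analytic_comp (f phi : C -> C) :
  analytic_on_disk f -> analytic_on_disk phi ->
  (forall z, in_disk z -> in_disk (phi z)) ->
  analytic_on_disk (composition_operator phi f).
Proof.
  intros Hf Hphi Hd z Hz.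
  destruct (Hf (phi z) (Hd z Hz)) as [df Hdf], (Hphi z Hz) as [dphi Hdphi].
  exists (scal (dphi : C_AbsRing) (df : C_NormedModule)).
  apply (is_derive_comp (K := C_AbsRing) (V := C_NormedModule) f phi); [exact Hdf|].
  (* The two normed-module structures of [C] over itself have the same norm
     but are not convertible. *)
  destruct Hdphi as [[Hp Hs Hn] Hdom]; split; [split; assumption | exact Hdom].
Qed.

Lemma Cmod_lt_1_plus (x : C) : Cmod x < 1 -> (1 + x)%C <> 0.
Proof.
  intros Hx H0.
  assert (x = (- (1))%C) by (replace x with (1 + x - 1)%C by ring; rewrite H0; ring).
  subst x; rewrite Cmod_m1 in Hx; lra.
Qed.

(** * Power series after a Moebius substitution *)

Definition mobius (s : R) (u : C) : C := ((u + s) / (1 + s * u))%C.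

(** Passing from one power to the next, the recursion gives [(1 + s u) Q = (u + s) P] for partial
    sums up to a remainder, and [1 + s u] is invertible on the disk. *)
Lemma mobius_pseries (s : R) (u : C) (m : nat) : 0 <= s < 1 -> Cmod u < 1 ->
  is_pseries (K := C_AbsRing) (V := C_NormedModule)
    (fun k => RtoC (mobius_coef s m k)) u (mobius s u ^ m)%C.
Proof.
  intros Hs Hu.
  assert (Hsu : (1 + s * u)%C <> 0).
  { apply Cmod_lt_1_plus; rewrite Cmod_mult, Cmod_R, Rabs_pos_eq by lra.
    pose proof (Cmod_ge_0 u); nra. }
  induction m as [|m IH]; apply is_pseries_C; [|apply is_pseries_C in IH].
  - apply is_lim_seq_ext with (fun _ => 0); [|apply is_lim_seq_const].
    intros n; symmetry; replace (_ - _)%C with (RtoC 0); [apply Cmod_0|].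
    induction n as [|n IH]; [rewrite sum_O; simpl; ring|].
    rewrite sum_Sn_C; simpl (mobius_coef s 0 (S n)).
    transitivity (sum_n (fun k => u ^ k * mobius_coef s 0 k)%C n - mobius s u ^ 0)%C;
      [exact IH | ring].
  - set (P := fun n => sum_n (fun k => u ^ k * mobius_coef s m k)%C n) in *.
    set (Q := fun n => sum_n (fun k => u ^ k * mobius_coef s (S m) k)%C n).
    (* The last term is the remainder: it is the product of [s u] with the last summand of
       [Q (S n)], and tends to 0 since the coefficients are bounded and [Cmod u < 1]. *)
    assert (HQ : forall n, ((1 + s * u) * Q (S n)
       = s * P (S n) + u * P n + s * u ^ (n + 2) * mobius_coef s (S m) (S n))%C).
    { induction n as [|n IHn].
      - unfold P, Q; rewrite !sum_Sn_C, !sum_O.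
        rewrite (mobius_coef_SS s m 0), mobius_coef_S0.
        rewrite ?RtoC_minus, ?RtoC_plus, ?RtoC_mult; simpl; ring.
      - assert (HQ1 : Q (S (S n)) = (Q (S n) + u ^ S (S n) * mobius_coef s (S m) (S (S n)))%C)
          by apply sum_Sn_C.
        assert (HP1 : P (S (S n)) = (P (S n) + u ^ S (S n) * mobius_coef s m (S (S n)))%C)
          by apply sum_Sn_C.
        assert (HP0 : P (S n) = (P n + u ^ S n * mobius_coef s m (S n))%C)
          by apply sum_Sn_C.
        rewrite HQ1, Cmult_plus_distr_l, IHn, HP1.
        replace (u * P (S n))%C with (u * (P n + u ^ S n * mobius_coef s m (S n)))%C
          by now rewrite HP0.
        rewrite (mobius_coef_SS s m (S n)).
        replace (n + 2)%nat with (S (S n)) by lia.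
        replace (S n + 2)%nat with (S (S (S n))) by lia.
        rewrite RtoC_minus, RtoC_plus, !RtoC_mult, !Cpow_S; ring. }
    destruct (mobius_coef_decay ((s + 1) / 2) (S m) ltac:(lra) s ltac:(lra)) as [M [HM Hdec]].
    apply (is_lim_seq_incr_1 (fun n => Cmod (Q n - mobius s u ^ S m)%C)).
    apply is_lim_seq_0_le with (fun n => / Cmod (1 + s * u)%C *
      (Cmod (P (S n) - mobius s u ^ m)%C + Cmod (P n - mobius s u ^ m)%C + M * Cmod u ^ n)).
    + intros n; split; [apply Cmod_ge_0|].
      replace (Q (S n) - mobius s u ^ S m)%C with
        ((s * (P (S n) - mobius s u ^ m) + u * (P n - mobius s u ^ m)
          + s * u ^ (n + 2) * mobius_coef s (S m) (S n)) / (1 + s * u))%C.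
      2:{ replace (Q (S n)) with (((1 + s * u) * Q (S n)) / (1 + s * u))%C by (field; auto).
          rewrite HQ, Cpow_S; unfold mobius at 3; field; auto. }
      rewrite Cmod_div by auto; unfold Rdiv; rewrite Rmult_comm.
      apply Rmult_le_compat_l; [apply Rlt_le, Rinv_0_lt_compat, Cmod_gt_0, Hsu|].
      eapply Rle_trans; [apply Cmod_triangle|]; apply Rplus_le_compat;
        [eapply Rle_trans; [apply Cmod_triangle|]; apply Rplus_le_compat|].
      * rewrite Cmod_mult, Cmod_R, Rabs_pos_eq by lra.
        pose proof (Cmod_ge_0 (P (S n) - mobius s u ^ m)%C); nra.
      * rewrite Cmod_mult; pose proof (Cmod_ge_0 (P n - mobius s u ^ m)%C).
        pose proof (Cmod_ge_0 u); nra.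
      * rewrite !Cmod_mult, !Cmod_R, Cmod_pow, (Rabs_pos_eq s), pow_add by lra.
        assert (Hc : Rabs (mobius_coef s (S m) (S n)) <= M).
        { eapply Rle_trans; [apply Hdec; lra|].
          assert (((s + 1) / 2) ^ S n <= 1); [|nra].
          apply Rle_trans with (1 ^ S n); [apply pow_incr; lra | rewrite pow1; lra]. }
        pose proof (Rabs_pos (mobius_coef s (S m) (S n))).
        pose proof (Cmod_ge_0 u).
        assert (0 <= Cmod u ^ n) by (now apply pow_le).
        rewrite Rmult_comm; apply Rmult_le_compat; auto.
        { apply Rmult_le_pos; [lra|]; apply Rmult_le_pos; [auto | apply pow2_ge_0]. }
        assert (0 <= Cmod u ^ 2 <= 1) by (split; [apply pow2_ge_0 | nra]).
        replace (s * (Cmod u ^ n * Cmod u ^ 2)) with (Cmod u ^ n * (s * Cmod u ^ 2)) by ring.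
        assert (s * Cmod u ^ 2 <= 1) by nra.
        nra.
    + replace (Finite 0) with (Finite (/ Cmod (1 + s * u)%C * (0 + 0 + M * 0)))
        by (f_equal; ring).
      apply (is_lim_seq_scal_l _ _ (0 + 0 + M * 0)).
      apply is_lim_seq_plus'; [apply is_lim_seq_plus'; [|exact IH]|].
      * now apply (is_lim_seq_incr_1 (fun n => Cmod (P n - mobius s u ^ m)%C)).
      * apply (is_lim_seq_scal_l _ M 0), is_lim_seq_geom.
        rewrite Rabs_pos_eq; [exact Hu | apply Cmod_ge_0].
Qed.

Lemma sum_n_mult_minus_C (c f g : nat -> C) n :
  (sum_n (fun k => c k * f k) n - sum_n (fun k => c k * g k) n)%C
  = sum_n (fun k => c k * (f k - g k))%C n.
Proof.
  induction n as [|n IH]; [rewrite !sum_O; ring|].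
  rewrite !sum_Sn_C, <- IH; ring.
Qed.

Definition mobius_image_C (s : R) (a : nat -> C) (k : nat) : C :=
  (mobius_image s (fun m => Re (a m)) k, mobius_image s (fun m => Im (a m)) k).

Definition image_coef_C (a : nat -> C) (M : nat) (s : R) (k : nat) : C :=
  sum_n (fun m => a m * mobius_coef s m k)%C M.

Lemma image_coef_C_pseries (s : R) (u : C) (a : nat -> C) (M : nat) :
  0 <= s < 1 -> Cmod u < 1 ->
  is_pseries (K := C_AbsRing) (V := C_NormedModule) (image_coef_C a M s) u
    (sum_n (fun m => mobius s u ^ m * a m)%C M).
Proof.
  intros Hs Hu; induction M as [|M IH].
  - rewrite sum_O, Cmult_comm.
    eapply is_pseries_ext;
      [|exact (is_pseries_scal (a O : C_AbsRing) _ _ _ (Cmult_comm u (a O))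
                 (mobius_pseries s u 0 Hs Hu))].
    intros k; unfold image_coef_C; now rewrite sum_O.
  - rewrite sum_Sn_C, (Cmult_comm _ (a (S M))).
    eapply is_pseries_ext;
      [|exact (is_pseries_plus _ _ _ _ _ IH (is_pseries_scal (a (S M) : C_AbsRing) _ _ _
                 (Cmult_comm u (a (S M))) (mobius_pseries s u (S M) Hs Hu)))].
    intros k; unfold image_coef_C; now rewrite sum_Sn_C.
Qed.

Lemma Re_image_coef_C a M s k :
  Re (image_coef_C a M s k) = image_coef (fun m => Re (a m)) M s k.
Proof.
  unfold image_coef_C; rewrite Re_sum_n; apply sum_n_ext_R; intros m.
  unfold Re; simpl; ring.
Qed.

Lemma Im_image_coef_C a M s k :
  Im (image_coef_C a M s k) = image_coef (fun m => Im (a m)) M s k.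
Proof.
  unfold image_coef_C; rewrite Im_sum_n; apply sum_n_ext_R; intros m.
  unfold Im; simpl; ring.
Qed.

Definition finite_energy_C (w : nat -> R) (a : nat -> C) : Prop :=
  ex_series (fun k => Cmod (a k) ^ 2 * beta w k ^ 2).
Definition energy_C (w : nat -> R) (a : nat -> C) : R :=
  Series (fun k => Cmod (a k) ^ 2 * beta w k ^ 2).

Lemma finite_energy_C_parts (w : nat -> R) (a : nat -> C) :
  finite_energy_C w a <->
  finite_energy w (fun k => Re (a k)) /\ finite_energy w (fun k => Im (a k)).
Proof.
  split.
  - intros H; split;
      (refine (ex_series_le (V := R_CompleteNormedModule) _ _ _ H); intros k;
       change (norm ?x) with (Rabs x); rewrite Rabs_pos_eq
         by (apply Rmult_le_pos; apply pow2_ge_0);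
       rewrite Cmod2_alt; pose proof (pow2_ge_0 (beta w k));
       pose proof (pow2_ge_0 (Re (a k))); pose proof (pow2_ge_0 (Im (a k))); nra).
  - intros [H1 H2]; eapply ex_series_ext; [|exact (ex_series_plus _ _ H1 H2)].
    intros k; rewrite Cmod2_alt; unfold plus; simpl; ring.
Qed.

Lemma energy_C_parts (w : nat -> R) (a : nat -> C) : finite_energy_C w a ->
  energy_C w a = energy w (fun k => Re (a k)) + energy w (fun k => Im (a k)).
Proof.
  intros H; apply finite_energy_C_parts in H; destruct H as [H1 H2].
  unfold energy_C, energy; rewrite <- Series_plus by assumption.
  apply Series_ext; intros k; rewrite Cmod2_alt; ring.
Qed.

Lemma mobius_image_C_energy (N : nat) (w : nat -> R) (s : R) (a : nat -> C) :
  weight_sequence w -> polynomial_growth N w -> 0 <= s < 1 -> finite_energy_C w a ->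
  finite_energy_C w (mobius_image_C s a) /\
  energy_C w (mobius_image_C s a) <= growth_factor N s * energy_C w a.
Proof.
  intros Hw Hg Hs Ha.
  destruct (proj1 (finite_energy_C_parts w a) Ha) as [H1 H2].
  destruct (mobius_image_energy N w s _ Hw Hg Hs H1) as [H1' B1].
  destruct (mobius_image_energy N w s _ Hw Hg Hs H2) as [H2' B2].
  assert (Hf : finite_energy_C w (mobius_image_C s a))
    by (apply finite_energy_C_parts; split; assumption).
  split; [exact Hf|].
  rewrite (energy_C_parts _ _ Hf), (energy_C_parts _ _ Ha), Rmult_plus_distr_l.
  now apply Rplus_le_compat.
Qed.

Lemma evaluation_ex_series (w : nat -> R) (r : R) : weight_sequence w -> 0 <= r < 1 ->
  ex_series (fun k => r ^ k / beta w k).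
Proof.
  intros Hw Hr.
  (* The ratio test wants nonzero terms and [r] may be 0, hence the comparison with a larger
     positive [q]. *)
  set (q := (r + 1) / 2); assert (Hq : 0 < q < 1) by (unfold q; lra).
  assert (Hb := beta_pos w Hw).
  assert (Hex : ex_series (fun k => Rabs (q ^ k / beta w k))).
  { apply (ex_series_DAlembert _ q); [lra| |].
    - intros k; apply Rgt_not_eq, Rdiv_lt_0_compat; [apply pow_lt; lra | apply Hb].
    - apply is_lim_seq_ext with (fun k => q * / w (S k)).
      + intros k; pose proof (Hb k).
        assert (0 < w (S k)) by (apply Hw; lia).
        assert (0 < q ^ k) by (apply pow_lt; lra).
        rewrite Rabs_pos_eq.
        * simpl; field; repeat split; lra.
        * apply Rlt_le; repeat apply Rdiv_lt_0_compat; auto; try apply pow_lt; lra.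
      + replace (Finite q) with (Finite (q * / 1)) by (f_equal; field).
        apply (is_lim_seq_scal_l _ q (/ 1)).
        apply (is_lim_seq_inv (fun k => w (S k)) 1).
        * apply (is_lim_seq_incr_1 w), Hw.
        * intros H; injection H; lra. }
  refine (ex_series_le (V := R_CompleteNormedModule) _ _ _ Hex); intros k.
  change (Rabs (r ^ k / beta w k) <= Rabs (q ^ k / beta w k)).
  assert (0 < / beta w k) by apply Rinv_0_lt_compat, Hb.
  assert (r ^ k <= q ^ k) by (apply pow_incr; unfold q; lra).
  assert (0 <= r ^ k) by (apply pow_le; lra).
  unfold Rdiv; rewrite !Rabs_pos_eq by (apply Rmult_le_pos; lra).
  apply Rmult_le_compat_r; lra.
Qed.

(** An interchange of limits: replacing [a] by its truncation at [M] changes every partial sum at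
    [u] by at most [G * eta M], whatever its length. With [M] fixed so that this and the truncation
    error at [mobius s u] are small, only the convergence for a polynomial remains. *)
Lemma mobius_image_C_pseries (N : nat) (w : nat -> R) (s : R) (a : nat -> C) (u l : C) :
  weight_sequence w -> polynomial_growth N w -> 0 <= s < 1 -> Cmod u < 1 ->
  finite_energy_C w a ->
  is_pseries (K := C_AbsRing) (V := C_NormedModule) a (mobius s u) l ->
  is_pseries (K := C_AbsRing) (V := C_NormedModule) (mobius_image_C s a) u l.
Proof.
  intros Hw Hg Hs Hu Ha Hl; apply is_pseries_C in Hl; apply is_pseries_C.
  destruct (proj1 (finite_energy_C_parts w a) Ha) as [H1 H2].
  set (are := fun m => Re (a m)) in *; set (aim := fun m => Im (a m)) in *.
  set (eta := fun M => sqrt (growth_factor N s * (energy w are - partial_energy w are M)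
                           + growth_factor N s * (energy w aim - partial_energy w aim M))).
  set (G := Series (fun k => Cmod u ^ k / beta w k)).
  assert (Hu0 := Cmod_ge_0 u).
  assert (HG : ex_series (fun k => Cmod u ^ k / beta w k))
    by (apply evaluation_ex_series; auto).
  assert (Hb := beta_pos w Hw).
  assert (Hterm : forall M k,
    Cmod (mobius_image_C s a k - image_coef_C a M s k)%C * beta w k <= eta M).
  { intros M k; unfold eta.
    rewrite <- (sqrt_pow2 (_ * beta w k))
      by (apply Rmult_le_pos; [apply Cmod_ge_0 | now apply Rlt_le]).
    apply sqrt_le_1_alt; rewrite Rpow_mult_distr, Cmod2_alt.
    change (Re (?x - ?y)%C) with (Re x - Re y).
    change (Im (?x - ?y)%C) with (Im x - Im y).
    rewrite Re_image_coef_C, Im_image_coef_C; fold are aim; simpl Re; simpl Im; fold are aim.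
    pose proof (mobius_image_tail N w s are M k Hw Hg Hs H1).
    pose proof (mobius_image_tail N w s aim M k Hw Hg Hs H2).
    lra. }
  assert (Heta : is_lim_seq eta 0).
  { assert (Hd : forall c, finite_energy w c ->
      is_lim_seq (fun M => growth_factor N s * (energy w c - partial_energy w c M)) 0).
    { intros c Hc.
      replace (Finite 0) with (Finite (growth_factor N s * (energy w c - energy w c)))
        by (f_equal; ring).
      apply (is_lim_seq_scal_l _ (growth_factor N s) (energy w c - energy w c)).
      apply is_lim_seq_minus'; [apply is_lim_seq_const | exact (Series_correct _ Hc)]. }
    rewrite <- sqrt_0.
    apply is_lim_seq_continuous; [apply continuity_pt_sqrt; lra|].
    replace (Finite 0) with (Finite (0 + 0)) by (f_equal; ring).
    apply is_lim_seq_plus'; auto. }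
  assert (Hsum : forall M n,
    Cmod (sum_n (fun k => u ^ k * mobius_image_C s a k)%C n
          - sum_n (fun k => u ^ k * image_coef_C a M s k)%C n)%C <= G * eta M).
  { intros M n.
    rewrite sum_n_mult_minus_C.
    eapply Rle_trans; [apply (Cmod_sum_n_le _ (fun k => eta M * (Cmod u ^ k / beta w k)))|].
    - intros k; rewrite Cmod_mult, Cmod_pow.
      specialize (Hterm M k); apply Rle_div_r in Hterm; [|apply Hb].
      apply Rle_trans with (Cmod u ^ k * (eta M / beta w k)); [|right; unfold Rdiv; ring].
      apply Rmult_le_compat_l; [now apply pow_le | exact Hterm].
    - rewrite sum_n_mult_l_R, Rmult_comm.
      apply Rmult_le_compat_r; [apply sqrt_pos|].
      apply sum_n_le_Series; [|exact HG].
      intros k; apply Rmult_le_pos; [now apply pow_le|]; apply Rlt_le, Rinv_0_lt_compat, Hb. }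
  assert (HG0 : is_lim_seq (fun M => G * eta M
     + Cmod (sum_n (fun m => mobius s u ^ m * a m)%C M - l)%C) 0).
  { replace (Finite 0) with (Finite (G * 0 + 0)) by (f_equal; ring).
    apply is_lim_seq_plus'; [|exact Hl].
    now apply (is_lim_seq_scal_l eta G 0). }
  apply is_lim_seq_spec; intros eps.
  apply is_lim_seq_spec in HG0.
  destruct (HG0 (pos_div_2 eps)) as [M HM]; specialize (HM M (le_n M)).
  pose proof (image_coef_C_pseries s u a M Hs Hu) as HP.
  apply is_pseries_C, is_lim_seq_spec in HP.
  destruct (HP (pos_div_2 eps)) as [n0 Hn0]; exists n0; intros n Hn.
  specialize (Hn0 n Hn); specialize (Hsum M n); simpl in HM, Hn0.
  rewrite Rminus_0_r in *.
  rewrite (Rabs_pos_eq (Cmod _)) in Hn0 by apply Cmod_ge_0.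
  rewrite Rabs_pos_eq by apply Cmod_ge_0.
  apply Rabs_lt_between in HM.
  set (X := sum_n (fun k => u ^ k * mobius_image_C s a k)%C n) in *.
  set (Y := sum_n (fun k => u ^ k * image_coef_C a M s k)%C n) in *.
  set (Z := sum_n (fun m => mobius s u ^ m * a m)%C M) in *.
  replace (X - l)%C with ((X - Y) + ((Y - Z) + (Z - l)))%C by ring.
  pose proof (Cmod_triangle (X - Y) ((Y - Z) + (Z - l))).
  pose proof (Cmod_triangle (Y - Z) (Z - l)).
  lra.
Qed.

(** * Composition with an automorphism *)

(** Write [z0 = |z0| mu] with [mu] unimodular; then [z0 - z = mu (|z0| - Cconj mu * z)], which
    suggests [nu = - Cconj mu] and [lam = e^(i theta) mu]. *)
Lemma automorphism_factor (theta : R) (z0 : C) : in_disk z0 ->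
  exists lam nu : C, Cmod lam = 1 /\ Cmod nu = 1 /\
    forall z, in_disk z ->
      ((cos theta, sin theta) * ((z0 - z) / (1 - Cconj z0 * z)))%C
      = (lam * mobius (Cmod z0) (nu * z))%C.
Proof.
  intros Hz0; unfold in_disk in Hz0.
  assert (Hmu : exists mu : C, Cmod mu = 1 /\ z0 = (Cmod z0 * mu)%C).
  { destruct (Req_dec (Cmod z0) 0) as [H0|H0].
    - exists 1%C; split; [apply Cmod_1|].
      rewrite H0, Cmult_0_l; apply Cmod_eq_0, H0.
    - assert (Hc : RtoC (Cmod z0) <> 0) by (intros H; apply H0; now injection H).
      exists (z0 / Cmod z0)%C; split; [|now field].
      rewrite Cmod_div, Cmod_R, Rabs_pos_eq by (auto; apply Cmod_ge_0); now field. }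
  destruct Hmu as [mu [Hmu Hz]].
  assert (Hconj : (mu * Cconj mu)%C = 1%C) by (now rewrite <- Cmod2_conj, Hmu, pow1).
  set (r := Cmod z0) in *.
  exists ((cos theta, sin theta) * mu)%C, (- Cconj mu)%C; repeat split.
  - rewrite Cmod_mult, Hmu, Rmult_1_r; unfold Cmod; simpl fst; simpl snd.
    rewrite <- sqrt_1; f_equal; rewrite <- (sin2_cos2 theta); unfold Rsqr; ring.
  - now rewrite Cmod_opp, Cmod_conj.
  - intros z Hzd; unfold in_disk in Hzd.
    assert (Hcz : Cconj z0 = (r * Cconj mu)%C).
    { rewrite Hz, Cmult_conj; f_equal; unfold Cconj, RtoC; simpl; now rewrite Ropp_0. }
    assert (Hd : (1 - r * Cconj mu * z)%C <> 0).
    { apply (Cmod_lt_1_plus (- (r * Cconj mu * z))%C).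
      rewrite Cmod_opp, !Cmod_mult, Cmod_conj, Hmu, Cmod_R.
      rewrite Rabs_pos_eq by apply Cmod_ge_0.
      pose proof (Cmod_ge_0 z); pose proof (Cmod_ge_0 z0 : 0 <= r); fold r; nra. }
    unfold mobius; rewrite Hcz.
    replace (1 + r * (- Cconj mu * z))%C with (1 - r * Cconj mu * z)%C by ring.
    replace (z0 - z)%C with (mu * (- Cconj mu * z + r))%C.
    + field; exact Hd.
    + rewrite Hz; transitivity (- (mu * Cconj mu) * z + r * mu)%C; [ring|].
      rewrite Hconj; ring.
Qed.

Lemma fhat_spec (f : C -> C) (a : nat -> C) :
  power_series_on_disk f a -> power_series_on_disk f (fhat f).
Proof.
  intros H; unfold fhat; apply ClassicalEpsilon.epsilon_spec; now exists a.
Qed.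

Lemma is_pseries_dilate (a : nat -> C) (lam z l : C) :
  is_pseries (K := C_AbsRing) (V := C_NormedModule) a (lam * z)%C l <->
  is_pseries (K := C_AbsRing) (V := C_NormedModule) (fun k => lam ^ k * a k)%C z l.
Proof.
  rewrite !is_pseries_C.
  split; apply is_lim_seq_ext; intros n; do 2 f_equal; apply sum_n_ext_C; intros k;
    rewrite Cpow_mult_l; ring.
Qed.

(** The two rotations multiply coefficients by powers of unimodular numbers, which leaves every term
    of the norm unchanged; only the Moebius factor in between costs [growth_factor N s]. Here [A]
    belongs to [f (lam * z)] and [B] to the full composition. *)
Lemma composition_in_H2 (N : nat) (w : nat -> R) (phi f : C -> C) (s : R) (lam nu : C) :
  weight_sequence w -> polynomial_growth N w -> 0 <= s < 1 ->
  disk_automorphism phi -> Cmod lam = 1 -> Cmod nu = 1 ->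
  (forall z, in_disk z -> phi z = (lam * mobius s (nu * z))%C) ->
  in_H2 w f ->
  in_H2 w (composition_operator phi f) /\
  Series (H2_norm_term w (composition_operator phi f))
    <= growth_factor N s * Series (H2_norm_term w f).
Proof.
  intros Hw Hg Hs [Hphi [Hdisk _]] Hlam Hnu Hfac [Hf [Hps Hfin]].
  set (A := fun m => (lam ^ m * fhat f m)%C).
  assert (HA : forall m, H2_norm_term w f m = Cmod (A m) ^ 2 * beta w m ^ 2).
  { intros m; unfold A; rewrite Cmod_mult, Cmod_pow, Hlam, pow1, Rmult_1_l; reflexivity. }
  assert (HAfin : finite_energy_C w A) by (apply (ex_series_ext _ _ HA), Hfin).
  set (B := fun k => (nu ^ k * mobius_image_C s A k)%C).
  assert (HBps : power_series_on_disk (composition_operator phi f) B).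
  { intros z Hz; apply (proj1 (is_pseries_dilate _ nu z _)), (mobius_image_C_pseries N w); auto.
    - rewrite Cmod_mult, Hnu, Rmult_1_l; exact Hz.
    - apply (proj1 (is_pseries_dilate _ lam _ _)); rewrite <- Hfac by exact Hz.
      apply Hps, Hdisk, Hz. }
  pose proof (fhat_spec _ _ HBps) as Hhat.
  assert (HB : forall k, Cmod (mobius_image_C s A k) ^ 2 * beta w k ^ 2
                         = H2_norm_term w (composition_operator phi f) k).
  { intros k; unfold H2_norm_term.
    rewrite (power_series_unique _ _ _ Hhat HBps k); unfold B.
    rewrite Cmod_mult, Cmod_pow, Hnu, pow1, Rmult_1_l; reflexivity. }
  destruct (mobius_image_C_energy N w s A Hw Hg Hs HAfin) as [Hfin' Hle].
  split.
  - split; [now apply analytic_comp | split; [exact Hhat|]].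
    exact (ex_series_ext _ _ HB Hfin').
  - rewrite <- (Series_ext _ _ HB), (Series_ext _ _ HA); exact Hle.
Qed.

(** From [(1 + r) / (1 - r) <= 2 / (1 - r)]. The square root halves the exponent, hence the
    condition on [2 * E]; the power of 2 is left unhalved for simplicity. *)
Lemma growth_factor_le (N E : nat) (r : R) : 0 <= r < 1 -> (2 * N + 1 <= 2 * E)%nat ->
  sqrt (growth_factor N r) <= 2 ^ (2 * N + 1) / (1 - r) ^ E.
Proof.
  intros Hr HE.
  assert (Hd : 1 <= / (1 - r)) by (rewrite <- Rinv_1 at 1; apply Rinv_le_contravar; lra).
  set (d := / (1 - r)) in *.
  assert (H2 : 1 <= 2 ^ (2 * N + 1)) by (apply pow_R1_Rle; lra).
  assert (Hx : 2 ^ (2 * N + 1) / (1 - r) ^ E = 2 ^ (2 * N + 1) * d ^ E)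
    by (unfold Rdiv, d; now rewrite pow_inv).
  rewrite Hx.
  assert (HdE : 1 <= d ^ E) by (apply pow_R1_Rle; lra).
  rewrite <- (sqrt_pow2 (2 ^ (2 * N + 1) * d ^ E)) by nra.
  apply sqrt_le_1_alt; unfold growth_factor.
  apply Rle_trans with ((2 * d) ^ (2 * N + 1)).
  - apply pow_incr; split; [apply Rlt_le, Rdiv_lt_0_compat; lra|].
    unfold Rdiv; fold d; apply Rmult_le_compat_r; lra.
  - rewrite Rpow_mult_distr.
    replace ((2 ^ (2 * N + 1) * d ^ E) ^ 2)
      with (2 ^ (2 * N + 1) * 2 ^ (2 * N + 1) * d ^ (2 * E))
      by (rewrite (Nat.mul_comm 2 E), pow_mult; ring).
    assert (d ^ (2 * N + 1) <= d ^ (2 * E)) by (now apply Rle_pow).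
    assert (0 <= d ^ (2 * N + 1)) by (apply pow_le; lra).
    apply Rmult_le_compat; nra.
Qed.

Theorem theorem2p12 (N : nat) (hN : (1 <= N)%nat) (w : nat -> R)
    (hw : weight_sequence w) (hgrowth : polynomial_growth N w) :
  exists K : R, 0 < K /\
    forall (phi : C -> C) (theta : R) (z0 : C),
      disk_automorphism phi ->
      in_disk z0 ->
      (forall z : C, in_disk z ->
         phi z = ((cos theta, sin theta) * ((z0 - z) / (1 - Cconj z0 * z)))%C) ->
      maps_H2_to_H2 w (composition_operator phi) /\
      Rbar_le (operator_norm w (composition_operator phi))
              (K / (1 - Cmod z0) ^ (2 * N ^ 2 + 3 * N + 2)).
Proof.
  (* The constant depends on [N] alone, so it can be fixed before the automorphism. *)
  exists (2 ^ (2 * N + 1)); split; [apply pow_lt; lra|].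
  intros phi theta z0 Hphi Hz0 Heq.
  destruct (automorphism_factor theta z0 Hz0) as [lam [nu [Hlam [Hnu Hfac]]]].
  assert (Hr : 0 <= Cmod z0 < 1) by (split; [apply Cmod_ge_0 | exact Hz0]).
  assert (Hcomp : forall f, in_H2 w f ->
    in_H2 w (composition_operator phi f) /\
    Series (H2_norm_term w (composition_operator phi f))
      <= growth_factor N (Cmod z0) * Series (H2_norm_term w f)).
  { intros f Hf; apply (composition_in_H2 N w phi f (Cmod z0) lam nu); auto.
    intros z Hz; now rewrite Heq, Hfac. }
  split; [intros f Hf; apply Hcomp, Hf|].
  apply Lub_Rbar_correct; intros r [f [Hf [Hnorm ->]]]; simpl.
  destruct (Hcomp f Hf) as [_ Hle].
  eapply Rle_trans; [|apply growth_factor_le; [exact Hr | simpl; nia]].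
  apply sqrt_le_1_alt; eapply Rle_trans; [exact Hle|].
  pose proof (growth_factor_pos N _ Hr).
  assert (Series (H2_norm_term w f) <= 1).
  { apply Rnot_lt_le; intros H1; apply (Rle_not_lt _ _ Hnorm).
    rewrite <- sqrt_1; apply sqrt_lt_1_alt; lra. }
  nra.
Qed.
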